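(* Let $(X,p)$ be a standard Borel space equipped with a probability measure. Let $(X',p')$ be obtained by equipping the set $X$ with a smaller (coarser) $\sigma$-algebra, i.e. any sub-$\sigma$-algebra of the given one, with $p'$ the restriction of $p$ to it. Then $(X',p')$ is isomorphic in $\mathsf{PS(Stoch)}$ to a standard Borel probability space.
   Context: A Markov kernel $k:X\to Y$ between measurable spaces assigns to $x\in X$ and measurable $B\subseteq Y$ a number $k(B|x)\in[0,1]$, being a probability measure in $B$ and measurable in $x$; composition is $(h\circ k)(C|x)=\int_Y h(C|y)\,k(dy|x)$, and identities are $(B,x)\mapsto 1_B(x)$. For a probability measure $p$ on $X$, kernels $f,g:X\to Y$ are $p$-almost surely equal, $f\simeq_p g$, if $\int_A f(B|x)\,p(dx)=\int_A g(B|x)\,p(dx)$ for all measurable $A\subseteq X$, $B\subseteq Y$. The category $\mathsf{PS(Stoch)}$ has probability spaces $(X,p)$ as objects; morphisms $(X,p)\to(Y,q)$ are $p$-a.s. equality classes of Markov kernels $f:X\to Y$ with $q(B)=\int_X f(B|x)\,p(dx)$ for all measurable $B\subseteq Y$. *)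

(* Defs.v *)
From HB Require Import structures.
From mathcomp Require Import all_boot all_order all_algebra.
From mathcomp Require Import generic_quotient.
From mathcomp Require Import all_classical all_reals all_analysis.
From mathcomp Require Import measurable_realfun.

Set Implicit Arguments.
Unset Strict Implicit.
Unset Printing Implicit Defensive.

Import Order.TTheory GRing.Theory Num.Theory.
Import numFieldNormedType.Exports.

Local Open Scope classical_set_scope.
Local Open Scope ring_scope.
Local Open Scope ereal_scope.
Local Open Scope quotient_scope.

(* A Polish space is a topological space whose topology comes from a complete
   separable metric; it is presented here by such a metric. *)
Definition polish (R : realType) (M : metricType R) : Prop :=
  (forall F : set_system M, ProperFilter F -> cauchy F ->
    exists x : M, F --> x) /\
  (exists2 D : set M, countable D & dense D).

(* [f] is a bijection under which the measurable sets of [X] correspond exactly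
   to the Borel sets of [M]. *)
Definition standard_borel (R : realType) d (X : measurableType d) : Prop :=
  exists (M : metricType R) (f : X -> M),
    [/\ polish M, bijective f &
        forall B : set M, <<s @open M >> B <-> measurable (f @^-1` B)].

Section markov_composition.
Context d0 d1 d2 (X : measurableType d0) (Y : measurableType d1)
  (Z : measurableType d2) (R : realType).
Variables (k : R.-pker X ~> Y) (h : R.-pker Y ~> Z).

Let prob_mkcomp_noparam x : mkcomp_noparam k h x [set: Z] = 1.
Proof.
rewrite /mkcomp_noparam /= /kcomp_noparam.
under eq_integral do rewrite prob_kernel.
by rewrite integral_cst// mul1e prob_kernel.
Qed.

HB.instance Definition _ :=
  isProbabilityKernel.Build _ _ X Z R (mkcomp_noparam k h) prob_mkcomp_noparam.

(* [markov_comp k h] is the composite "h after k". *)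
Definition markov_comp : R.-pker X ~> Z := mkcomp_noparam k h.

Lemma markov_compE x C : markov_comp x C = \int[k x]_y h y C.
Proof. by []. Qed.

End markov_composition.

Definition markov_id d (X : measurableType d) (R : realType) : R.-pker X ~> X :=
  kdirac (@measurable_id _ X setT).

Lemma markov_idE d (X : measurableType d) (R : realType) (x : X) (B : set X) :
  markov_id X R x B = (\1_B x)%:E.
Proof. by []. Qed.

Definition as_eq d d' (X : measurableType d) (Y : measurableType d')
    (R : realType) (p : probability X R) (f g : R.-pker X ~> Y) : Prop :=
  forall (A : set X) (B : set Y), measurable A -> measurable B ->
    \int[p]_(x in A) f x B = \int[p]_(x in A) g x B.

(* [krestr f mA] is [f] on [A] and zero outside; [mean_meas p f mA] is the
   measure sending [B] to the integral of [f x B] over [A]. *)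
Section restricted_mean.
Context d d' (X : measurableType d) (Y : measurableType d') (R : realType).
Variables (p : probability X R) (f : R.-pker X ~> Y).
Variables (A : set X) (mA : measurable A).

Definition krestr of measurable A : X -> {measure set Y -> \bar R} :=
  fun x => if x \in A then f x else mzero.

Let krestrE B : krestr mA ^~ B = (f ^~ B) \_ A.
Proof. by apply/funext => x; rewrite /krestr /patch; case: ifP. Qed.

Let measurable_krestr B : measurable B ->
  measurable_fun [set: X] (krestr mA ^~ B).
Proof.
move=> mB; rewrite krestrE; apply/(measurable_restrictT _ _).1 => //.
exact: (measurable_funTS (measurable_kernel f B mB)).
Qed.

HB.instance Definition _ := @isKernel.Build _ _ _ _ R (krestr mA)
  measurable_krestr.

Let krestr_le1 : ereal_sup [set krestr mA x [set: Y] | x in [set: X]] <= 1.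
Proof.
apply: ge_ereal_sup => _ [x _ <-]; rewrite /krestr.
by case: ifP => _; [rewrite prob_kernel|rewrite /mzero/= lee01].
Qed.

HB.instance Definition _ := Kernel_isSubProbability.Build _ _ _ _ R (krestr mA)
  krestr_le1.

Definition mean_meas : {measure set Y -> \bar R} :=
  mkcomp_noparam (kprobability (@measurable_cst _ _ unit _ setT
    (p : pprobability X R))) (krestr mA) tt.

Lemma mean_measE B : mean_meas B = \int[p]_(x in A) f x B.
Proof.
rewrite /mean_meas/= /mkcomp_noparam/= /kcomp_noparam /=.
by rewrite [RHS]integral_mkcond -krestrE.
Qed.

Lemma integral_mean_meas (u : Y -> \bar R) : (forall y, 0 <= u y) ->
  measurable_fun [set: Y] u ->
  \int[mean_meas]_y u y = \int[p]_(x in A) \int[f x]_y u y.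
Proof.
move=> u0 mu.
have := @integral_kcomp _ _ _ unit X Y R
  (kprobability (@measurable_cst _ _ unit _ setT (p : pprobability X R)))
  (kernel.kernel_snd (krestr mA)) tt u u0 mu.
move=> /= E; rewrite [LHS]E [RHS]integral_mkcond; apply: eq_integral => x _.
rewrite /kernel.kernel_snd /= /krestr /patch; case: ifP => // _.
by rewrite integral_measure_zero.
Qed.

End restricted_mean.

Record prob_space (R : realType) := ProbSpace {
  ps_disp : measure_display;
  ps_carrier :> measurableType ps_disp;
  ps_prob : probability ps_carrier R
}.
Arguments ProbSpace {R ps_disp} ps_carrier ps_prob.

Record ps_map (R : realType) (X Y : prob_space R) := PSMap {
  ps_ker :> R.-pker X ~> Y;
  ps_kerP : forall B : set Y, measurable B ->
    ps_prob Y B = \int[ps_prob X]_x ps_ker x B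
}.

HB.instance Definition _ (R : realType) (X Y : prob_space R) :=
  gen_eqMixin (ps_map X Y).
HB.instance Definition _ (R : realType) (X Y : prob_space R) :=
  gen_choiceMixin (ps_map X Y).

Definition ps_eq (R : realType) (X Y : prob_space R) : rel (ps_map X Y) :=
  fun f g => `[< as_eq (ps_prob X) f g >].

Lemma ps_eq_equiv (R : realType) (X Y : prob_space R) :
  equiv_class_of (@ps_eq R X Y).
Proof.
split=> [f|f g|g f h].
- exact/asboolP.
- by apply/asboolP/asboolP => + A B mA mB => ->.
- by move=> /asboolP fg /asboolP gh; apply/asboolP => A B mA mB; rewrite fg// gh.
Qed.

Canonical ps_eq_equiv_rel (R : realType) (X Y : prob_space R) :=
  EquivRelPack (@ps_eq_equiv R X Y).

(* Morphisms of PS(Stoch) are almost sure equality classes, hence a quotient. *)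
Definition ps_hom (R : realType) (X Y : prob_space R) : Type :=
  {eq_quot @ps_eq R X Y}.
Definition ps_class (R : realType) (X Y : prob_space R) (f : ps_map X Y) :
  ps_hom X Y := \pi f.
Definition ps_repr (R : realType) (X Y : prob_space R) (F : ps_hom X Y) :
  ps_map X Y := repr F.

Section ps_category.
Variable R : realType.
Implicit Types X Y Z : prob_space R.

Lemma ps_classP X Y (f g : ps_map X Y) :
  ps_class f = ps_class g <-> as_eq (ps_prob X) f g.
Proof.
by split=> [/eqmodP/asboolP//|fg]; apply/eqmodP/asboolP.
Qed.

Lemma ps_reprK X Y (F : ps_hom X Y) : ps_class (ps_repr F) = F.
Proof. exact: reprK. Qed.

Lemma ps_map_id_proof X (B : set X) : measurable B ->
  ps_prob X B = \int[ps_prob X]_x markov_id X R x B.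
Proof.
move=> mB; under eq_integral do rewrite markov_idE.
by rewrite integral_indic// setIT.
Qed.

Definition ps_map_id X : ps_map X X := PSMap (@ps_map_id_proof X).

Lemma ps_map_comp_proof X Y Z (f : ps_map X Y) (g : ps_map Y Z) (C : set Z) :
  measurable C ->
  ps_prob Z C = \int[ps_prob X]_x markov_comp f g x C.
Proof.
move=> mC; rewrite (ps_kerP g)//.
transitivity (\int[mean_meas (ps_prob X) f measurableT]_y g y C).
  by apply: eq_measure_integral => B mB _; rewrite mean_measE; exact: (ps_kerP f).
by rewrite integral_mean_meas//; exact: (measurable_kernel g C mC).
Qed.

Definition ps_map_comp X Y Z (f : ps_map X Y) (g : ps_map Y Z) : ps_map X Z :=
  PSMap (@ps_map_comp_proof X Y Z f g).

Lemma as_eq_comp X Y Z (f f' : ps_map X Y) (g g' : ps_map Y Z) :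
  as_eq (ps_prob X) f f' -> as_eq (ps_prob Y) g g' ->
  as_eq (ps_prob X) (ps_map_comp f g) (ps_map_comp f' g').
Proof.
move=> ff' gg' A C mA mC /=.
have mg (k : ps_map Y Z) : measurable_fun setT (k ^~ C).
  exact: measurable_kernel.
rewrite -!(integral_mean_meas _ _ mA)//.
transitivity (\int[mean_meas (ps_prob X) f mA]_y g' y C); last first.
  by apply: eq_measure_integral => B mB _; rewrite !mean_measE ff'.
apply: ae_eq_integral => //.
have [N [mN N0 sN]] : ae_eq (ps_prob Y) setT (g ^~ C) (g' ^~ C).
  apply: integral_ae_eq => // [|E _ mE]; last exact: gg'.
  apply/integrableP; split => //.
  apply: (@le_lt_trans _ _ (\int[ps_prob Y]_y cst 1 y)).
    apply: ge0_le_integral => //.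
    - exact/measurableT_comp.
    - move=> y _; rewrite gee0_abs// -(@prob_kernel _ _ _ _ _ g y).
      by apply: le_measure; rewrite ?inE.
  by rewrite integral_cst//= mul1e probability_setT ltry.
exists N; split => //; apply/eqP; rewrite mean_measE eq_le; apply/andP; split.
  rewrite -N0 [leRHS](ps_kerP f)//.
  apply: ge0_subset_integral => //.
  exact: measurable_kernel.
exact: integral_ge0.
Qed.

Definition ps_id X : ps_hom X X := ps_class (ps_map_id X).

(* Composition is in diagrammatic order: first [F], then [G]. *)
Definition ps_comp X Y Z (F : ps_hom X Y) (G : ps_hom Y Z) : ps_hom X Z :=
  ps_class (ps_map_comp (ps_repr F) (ps_repr G)).

Lemma ps_compE X Y Z (f : ps_map X Y) (g : ps_map Y Z) :
  ps_comp (ps_class f) (ps_class g) = ps_class (ps_map_comp f g).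
Proof. by apply/ps_classP; apply: as_eq_comp; apply/ps_classP/ps_reprK. Qed.

Lemma ps_comp1l X Y (F : ps_hom X Y) : ps_comp (ps_id X) F = F.
Proof.
rewrite -(ps_reprK F) ps_compE; apply/ps_classP => A B mA mB /=.
apply: eq_integral => x _; rewrite markov_compE integral_dirac//.
  by rewrite diracT mul1e.
exact: measurable_kernel.
Qed.

Lemma ps_comp1r X Y (F : ps_hom X Y) : ps_comp F (ps_id Y) = F.
Proof.
rewrite -(ps_reprK F) ps_compE; apply/ps_classP => A B mA mB /=.
apply: eq_integral => x _; rewrite markov_compE.
under eq_integral do rewrite markov_idE.
by rewrite integral_indic// setIT.
Qed.

Lemma ps_compA W X Y Z (F : ps_hom W X) (G : ps_hom X Y) (H : ps_hom Y Z) :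
  ps_comp F (ps_comp G H) = ps_comp (ps_comp F G) H.
Proof.
rewrite -(ps_reprK F) -(ps_reprK G) -(ps_reprK H) !ps_compE.
apply/ps_classP => A B mA mB /=; apply: eq_integral => x _.
rewrite !markov_compE; symmetry.
apply: (@integral_kcomp _ _ _ W X Y R (ps_repr F)
  (kernel.kernel_snd (ps_repr G)) x) => //.
exact: (measurable_kernel (ps_repr H) B mB).
Qed.

Definition ps_isomorphic X Y : Prop :=
  exists (F : ps_hom X Y) (G : ps_hom Y X),
    ps_comp F G = ps_id X /\ ps_comp G F = ps_id Y.

End ps_category.

(* Main.v *)
(* The sub-sigma-algebra is treated as a measure-preserving map [pi : X -> Z]
   (for the theorem, the identity). Embed [X] in the line as a measurable retract
   by [T]. The conditional probabilities [h n] of [T < r n] given [pi], [r n]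
   running over the rationals, are countably many measurable functions on [Z];
   coding all of them into one real number gives [Phi : Z -> R]. The conditional
   law of [x] given [pi x] depends on [h] only, hence is [k (Phi z)] for a kernel
   [k] from [R], built from the conditional quantile function. Therefore
   [\int_A k (Phi z) (pi^-1 B) = p' (A `&` B)], which says at once that [Phi] and
   [k] are mutually inverse almost surely. *)
Require Import Defs.
From HB Require Import structures.
From mathcomp Require Import all_boot all_order all_algebra.
From mathcomp Require Import all_classical all_reals all_analysis.
From mathcomp Require Import measurable_realfun lra.

Set Implicit Arguments.
Unset Strict Implicit.
Unset Printing Implicit Defensive.

Import Order.TTheory GRing.Theory Num.Theory.
Import numFieldNormedType.Exports.

Local Open Scope classical_set_scope.
Local Open Scope ring_scope.

(** * Coding countably many measurable sets and functions by one real function *)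

Lemma measurable_preimage d1 d2 (Y : measurableType d1) (Z : measurableType d2)
    (f : Y -> Z) (B : set Z) :
  measurable_fun setT f -> measurable B -> measurable (f @^-1` B).
Proof. by move=> mf mB; rewrite -[X in measurable X]setTI; exact: mf. Qed.

Lemma measurable_true d (Z : measurableType d) (b : Z -> bool) :
  measurable_fun setT b -> measurable [set z | b z].
Proof. by move=> mb; exact: (measurable_preimage (B := [set true]) mb). Qed.

Lemma measurable_fun_mem d (Z : measurableType d) (A : set Z) :
  measurable A -> measurable_fun setT (fun z => z \in A).
Proof.
move=> mA; apply: (measurable_fun_bool true); rewrite setTI.
rewrite (_ : _ @^-1` _ = A)//.
by apply/seteqP; split=> z /=; [exact: set_mem|exact: mem_set].
Qed.

(* Greedy base-3 expansion: the digits 0 and 1 can be read off because the tail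
   of the series from position [n.+1] on is at most half of [3^-n]. *)
Lemma countably_generated_code (R : realType) d (Z : measurableType d)
    (U : nat -> set Z) : (forall n, measurable (U n)) ->
  exists (Phi : Z -> R) (V : nat -> set R), measurable_fun setT Phi /\
    forall n, measurable (V n) /\ Phi @^-1` V n = U n.
Proof.
move=> mU; pose w n : R := (3^-1) ^+ n.
have w0 n : 0 < w n by rewrite exprn_gt0// invr_gt0.
have wS n : w n.+1 = w n / 3 by rewrite /w exprSr.
pose S n z : R := \sum_(k < n) w k * \1_(U k) z.
have SS n z : S n.+1 z = S n z + w n * \1_(U n) z by rewrite /S big_ord_recr.
have d01 n z : 0 <= (\1_(U n) z : R) <= 1.
  by rewrite indicE ler0n lern1 leq_b1.
have Snd z : nondecreasing_seq (S ^~ z).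
  apply/nondecreasing_seqP => n; rewrite SS lerDl mulr_ge0 ?(ltW (w0 n))//.
(* The weights [w k] with [k >= n] sum to [3 / 2 * w n]; keeping the subtracted remainder lets the
   induction on [m] close. *)
have Sub n m z : S (n + m)%N z <= S n z + 3 / 2 * w n - 3 / 2 * w (n + m)%N.
  elim: m => [|m IH]; first by rewrite addn0 addrK.
  rewrite addnS SS wS; have := w0 (n + m)%N; have /andP[_ ] := d01 (n + m)%N z.
  nra.
have Sub' n m z : S m z <= S n z + 3 / 2 * w n.
  rewrite (le_trans (Snd z _ _ (leq_addl n m)))// (le_trans (Sub _ _ _))//.
  by rewrite gerBl mulr_ge0// ltW.
have Scv z : cvgn (S ^~ z).
  apply: nondecreasing_is_cvgn; first exact: Snd.
  by exists (S 0 z + 3 / 2 * w 0) => _ [m _ <-]; exact: Sub'.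
pose Phi z : R := limn (S ^~ z).
have Phi_lb n z : S n z <= Phi z by apply: nondecreasing_cvgn_le.
have Phi_ub n z : Phi z <= S n z + 3 / 2 * w n.
  by apply: limr_le => //; apply: nearW => m; exact: Sub'.
(* [rem n t] removes the first [n] digits, read off greedily from [t] alone, so it is defined and
   measurable on the whole line. *)
pose rem := fix rem n (t : R) : R := if n is n'.+1 then
  rem n' t - w n' * (w n' <= rem n' t)%R%:R else t.
have digit n z : (w n <= Phi z - S n z) = (z \in U n).
  have := Phi_lb n.+1 z; have := Phi_ub n.+1 z; have := w0 n.
  rewrite SS wS indicE.
  by case: (z \in U n) => /= ? ? ?; apply/idP; lra.
have remE n z : rem n (Phi z) = Phi z - S n z.
  elim: n => [|n IH]; first by rewrite /S big_ord0 subr0.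
  by rewrite /= IH digit SS indicE opprD addrA.
have mrem n : measurable_fun setT (rem n).
  elim: n => [|n IH]; first exact: measurable_id.
  rewrite (_ : rem n.+1 = (fun t => rem n t -
      (if w n <= rem n t then w n else 0))).
    apply: measurable_funB => //; apply: measurable_fun_ifT => //.
    exact: measurable_fun_ler.
  by apply/funext => t /=; case: ifP => _; rewrite ?mulr1 ?mulr0.
exists Phi, (fun n => [set t | w n <= rem n t]); split=> [|n].
  apply: (measurable_fun_cvg (h := S)) => // n.
  apply: measurable_sum => k; apply: measurable_funM => //.
split; last first.
  by apply/seteqP; split=> z /=; rewrite remE digit inE.
exact/measurable_true/measurable_fun_ler.
Qed.

(** Each [f n z] is the supremum of the rationals below it, so the countably many sets where
    [q < f n z] determine all the [f n], and one real codes these sets. *)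
Lemma measurable_family_code (R : realType) d (Z : measurableType d)
    (f : nat -> Z -> R) : (forall n, measurable_fun setT (f n)) ->
  exists (Phi : Z -> R) (e : nat -> R -> R), measurable_fun setT Phi /\
    forall n, measurable_fun setT (e n) /\ e n \o Phi =1 f n.
Proof.
move=> mf.
pose U j : set Z := if unpickle j is Some (n, q)
  then [set z | ratr (q : rat) < f n z] else set0.
have mU j : measurable (U j).
  rewrite /U; case: unpickle => [[n q]|//].
  exact/measurable_true/measurable_fun_ltr.
have [Phi [V [mPhi VU]]] := countably_generated_code R mU.
(* The value [-oo] is neutral for the supremum. Off the range of [Phi] the supremum may be infinite;
   [fine] then returns 0. *)
pose u (n : nat) (t : R) (k : nat) : \bar R := if unpickle k is Some q then
  if t \in V (pickle (n, q)) then (ratr (q : rat))%:E else -oo%E else -oo%E.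
exists Phi, (fun n t => fine (esups (u n t) 0)); split=> // n; split.
  apply/(measurableT_comp (fine_measurable _)) => //.
  apply: measurable_fun_esups => k; rewrite /u.
  case: unpickle => [q|]; last exact: measurable_cst.
  apply: measurable_fun_ifT => //.
  exact: measurable_fun_mem (VU _).1.
move=> z /=; suff -> : esups (u n (Phi z)) 0%N = (f n z)%:E by [].
have uE q : u n (Phi z) (pickle q) =
    if ratr q < f n z then (ratr q)%:E else -oo%E.
  rewrite /u pickleK; congr (if _ then _ else _).
  have := (VU (pickle (n, q))).2; rewrite /U pickleK => /seteqP[VU1 VU2].
  by apply/idP/idP => [/set_mem/VU1//|/VU2/mem_set].
apply/eqP; rewrite eq_le; apply/andP; split.
  apply: ge_ereal_sup => _ [k _ <-]; rewrite /u.
  case E : unpickle => [q|]; last exact: leNye.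
  case: ifPn => [/set_mem tV|_]; last exact: leNye.
  have := (VU (pickle (n, q))).2; rewrite /U pickleK => /seteqP[VU1 _].
  by rewrite lee_fin ltW//; exact: VU1.
apply/lee_subgt0Pr => r r0; have : f n z - r < f n z by rewrite gtrBl.
move=> /rat_in_itvoo[q]; rewrite in_itv/= => /andP[rq qf].
apply: (@le_trans _ _ (ratr q)%:E); first by rewrite -EFinB lee_fin ltW.
by apply: ereal_sup_ubound; exists (pickle q) => //; rewrite uE qf.
Qed.

(** * Standard Borel spaces as measurable retracts of the line *)

Lemma open_mdist_lt (R : realType) (M : metricType R) (c : M) (r : R) :
  open [set y | mdist c y < r].
Proof.
rewrite openE => y /= cy; apply/nbhs_ballP; exists (r - mdist c y) => /=.
  by rewrite subr_gt0.
move=> z; rewrite ballEmdist/= ltrBrDl => yz.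
exact: le_lt_trans (metric_triangle _ _ _) yz.
Qed.

Lemma dense_mdist_lt (R : realType) (M : metricType R) (D : set M) (y : M)
    (r : R) :
  dense D -> 0 < r -> exists2 c, D c & mdist c y < r.
Proof.
move=> dD r0; have [|c [/= yc Dc]] := dD _ _ (open_mdist_lt y r).
  by exists y => /=; rewrite mdistxx.
by exists c => //; rewrite metric_sym.
Qed.

Lemma polish_dense_seq (R : realType) (M : metricType R) (D : set M) (y0 : M) :
  countable D -> dense D ->
  exists c : nat -> M, forall y (r : R), 0 < r -> exists n, mdist (c n) y < r.
Proof.
move=> cD dD; have [D0|/surjfunPex[c cE]] := pfcard_geP cD.
  by have [z] := dense_mdist_lt y0 dD (@ltr01 R); rewrite D0.
exists c => y r r0; have [z] := dense_mdist_lt y dD r0.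
by rewrite cE => -[n _ <-]; exists n.
Qed.

(* A vector [a] is the vector of distances from some point to the dense
   sequence [c] iff it satisfies these countably many inequalities: indices with
   [a n] small then give a Cauchy sequence. *)
Lemma distance_vectorP (R : realType) (M : metricType R) (c : nat -> M)
    (a : nat -> R) :
  (forall F : set_system M, ProperFilter F -> cauchy F ->
    exists x : M, F --> x) ->
  (forall y (r : R), 0 < r -> exists n, mdist (c n) y < r) ->
  (exists y, forall n, mdist (c n) y = a n) <->
  [/\ forall n m, mdist (c n) (c m) <= a n + a m,
      forall n m, a n <= mdist (c n) (c m) + a m &
      forall k, exists n, a n < k.+1%:R^-1].
Proof.
move=> cplM dc; split=> [[y ya]|[a1 a2 a3]].
  split=> [n m|n m|k]; rewrite -?ya.
  - by rewrite (metric_sym (c m)); exact: metric_triangle.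
  - exact: metric_triangle.
  - by have [|n cy] := dc y k.+1%:R^-1; [rewrite invr_gt0|exists n; rewrite -ya].
have [s sP] := choice a3.
have small (r : R) : 0 < r -> \forall k \near \oo, a (s k) < r.
  move=> r0; near=> k; apply: lt_trans (sP k) _.
  near: k; exact: near_infty_natSinv_lt (PosNum r0).
have [|y cy] := cplM (c \o s @ \oo).
  apply/cauchy_exP => r r0; have r20 : 0 < r / 2 by rewrite divr_gt0.
  near \oo => k0; exists (c (s k0)).
  have ak0 : a (s k0) < r / 2 by near: k0; exact: small.
  have := small _ r20; apply: filterS => k ak /=; rewrite ballEmdist/=.
  have := a1 (s k0) (s k); lra.
exists y => n; apply/eqP; rewrite eq_le.
have close (r : R) : 0 < r -> exists k, a (s k) < r /\ mdist (c (s k)) y < r.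
  move=> r0; near \oo => k; exists k; split.
    by near: k; exact: small.
  rewrite metric_sym; near: k.
  exact: (metricType_numDomainType.cvgr_dist_lt cy r0).
(* Going through a point [c (s k)] close to [y], [a1] bounds the distance above by [a n] and [a2]
   bounds it below, both up to [r]. *)
apply/andP; split; apply/ler_addgt0Pr => r r0.
all: have [|k [ak ck]] := close (r / 2); first by rewrite divr_gt0.
  have := metric_triangle (c n) (c (s k)) y; have := a1 n (s k); lra.
have := metric_triangle (c n) y (c (s k)); rewrite (metric_sym y).
have := a2 n (s k); lra.
Unshelve. all: by end_near.
Qed.

(** A point of a Polish space is determined by its distances to a dense sequence, and one real [T x]
    codes these countably many functions. Decoding is possible on the set [E] of codes of genuine
    distance vectors, which is Borel by [distance_vectorP]; this is where completeness enters. *)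
Lemma standard_borel_retract (R : realType) d (X : measurableType d) (x0 : X) :
  standard_borel R X ->
  exists (T : X -> R) (g : R -> X),
    [/\ measurable_fun setT T, measurable_fun setT g & cancel T g].
Proof.
move=> [M [f [[cplM [D cD dD]] [f' fK f'K] mf]]].
have [c cP] := polish_dense_seq (f x0) cD dD.
pose a n x := mdist (c n) (f x).
have ma n : measurable_fun setT (a n).
  apply: (measurability _ (RGenInftyO.measurableE R)) => _ [_ [r ->] <-].
  rewrite setTI (_ : _ @^-1` _ = f @^-1` [set y | mdist (c n) y < r]).
    by apply: (mf _).1; apply: sub_sigma_algebra; exact: open_mdist_lt.
  by apply/seteqP; split=> x /=; rewrite in_itv.
have [T [e [mT eT]]] := measurable_family_code ma.
pose E := [set t | exists x, forall n, a n x = e n t].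
have mE : measurable E.
  rewrite (_ : E =
    (\bigcap_n \bigcap_m [set t | mdist (c n) (c m) <= e n t + e m t])
    `&` (\bigcap_n \bigcap_m [set t | e n t <= mdist (c n) (c m) + e m t])
    `&` \bigcap_k \bigcup_n [set t | e n t < k.+1%:R^-1]); last first.
    apply/seteqP; split=> t.
      move=> [x xt].
      have /(distance_vectorP _ cplM cP)[h1 h2 h3] :
        exists y, forall n, mdist (c n) y = e n t by exists (f x).
      split; [split=> n _ m _ /=|move=> k _]; [exact: h1|exact: h2|].
      by have [n ?] := h3 k; exists n.
    move=> [[h1 h2] h3].
    have /(distance_vectorP _ cplM cP)[y yt] : [/\
      forall n m, mdist (c n) (c m) <= e n t + e m t,
      forall n m, e n t <= mdist (c n) (c m) + e m t &
      forall k, exists n, e n t < k.+1%:R^-1].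
      split=> [n m|n m|k]; [exact: h1|exact: h2|].
      by have [n _ ?] := h3 k I; exists n.
    by exists (f' y) => n; rewrite /a f'K.
  have me n : measurable_fun setT (e n) := (eT n).1.
  apply: measurableI; first apply: measurableI.
  - apply: bigcapT_measurable => n; apply: bigcapT_measurable => m.
    apply/measurable_true/measurable_fun_ler => //.
    exact: measurable_funD.
  - apply: bigcapT_measurable => n; apply: bigcapT_measurable => m.
    apply/measurable_true/measurable_fun_ler => //.
    exact: measurable_funD.
  - apply: bigcapT_measurable => k; apply: bigcupT_measurable => n.
    by exact/measurable_true/measurable_fun_ltr.
pose g t := xget x0 [set x | forall n, a n x = e n t].
have gE t : E t -> forall n, a n (g t) = e n t.
  move=> [x xt]; apply: (@xgetPex _ x0 [set x | forall n, a n x = e n t]).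
  by exists x.
have gE' t : ~ E t -> g t = x0.
  by move=> nEt; apply: xgetPN => x xt; apply: nEt; exists x.
(* Measurability of [g] is read off from these distances, which are [e n t] on [E] and constant off
   it. *)
have mag n : measurable_fun setT (fun t => a n (g t)).
  rewrite (_ : (fun t => _) = (fun t => if t \in E then e n t else a n x0)).
    apply: measurable_fun_ifT => //; last exact: (eT n).1.
    exact: measurable_fun_mem.
  apply/funext => t; case: ifPn => [/set_mem/gE->//|/negP nEt].
  by rewrite gE'// => /mem_set.
exists T, g; split=> //; last first.
  move=> x; have gTx n : a n (g (T x)) = a n x.
    by rewrite -[RHS](eT n).2; apply: gE; exists x => m; rewrite -(eT m).2.
  apply: (can_inj fK); apply: mdist_positivity.
  apply/eqP; rewrite eq_le mdist_ge0 andbT; apply/ler_addgt0Pr => r r0.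
  have r20 : 0 < r / 2 by rewrite divr_gt0.
  have [n cn] := cP (f x) _ r20; have := gTx n; rewrite /a.
  have := metric_triangle (f (g (T x))) (c n) (f x).
  rewrite (metric_sym _ (c n)); lra.
move=> _ B mB; rewrite setTI.
(* [B] is the pullback of a Borel set of [M], and the sets of [M] with measurable preimage under
   [f \o g] form a sigma-algebra, so open sets suffice. *)
have -> : B = f @^-1` (f' @^-1` B) by apply/seteqP; split=> x; rewrite /= fK.
have : <<s @open M >> (f' @^-1` B).
  apply: (mf _).2; rewrite (_ : _ @^-1` _ = B)//.
  by apply/seteqP; split=> x; rewrite /= fK.
move: (f' @^-1` B); apply: smallest_sub.
  split=> /=.
  - by rewrite !preimage_set0.
  - by move=> A mA; rewrite setTD; exact: measurableC.
  - by move=> F mF; rewrite !preimage_bigcup; exact: bigcupT_measurable.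
move=> O oO /=.
(* An open set is the union of the balls of radius [k.+1%:R^-1] about the [c n] that it contains. *)
rewrite (_ : _ @^-1` _ = \bigcup_n \bigcup_(k in
    [set k | [set y | mdist (c n) y < k.+1%:R^-1] `<=` O])
    [set t | a n (g t) < k.+1%:R^-1]).
  apply: bigcupT_measurable => n; apply: bigcup_measurable => k _.
  by exact/measurable_true/measurable_fun_ltr.
apply/seteqP; split=> [t /= Ot|t [n _ [k kO /kO]]//].
have /nbhs_ballP[r /= r0 rO] : nbhs (f (g t)) O by exact: open_nbhs_nbhs.
have r20 : 0 < r / 2 by rewrite divr_gt0.
near \oo => k; have kr : k.+1%:R^-1 < r / 2.
  by near: k; exact: near_infty_natSinv_lt (PosNum r20).
have [|n cn] := cP (f (g t)) k.+1%:R^-1; first by rewrite invr_gt0.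
exists n => //; exists k => // y /= cy; apply: rO; rewrite ballEmdist/=.
have := metric_triangle (f (g t)) (c n) y.
by rewrite (metric_sym _ (c n)); move: (_^-1) kr cn cy => q; lra.
Unshelve. all: by end_near.
Qed.

(** * Joint measures, image measures and kernels given by random maps *)

Section joint_meas.
Context d d' (X : measurableType d) (Z : measurableType d') (R : realType).
Variables (p : probability X R) (pi : X -> Z).
Hypothesis mpi : measurable_fun setT pi.
Variables (B : set X) (mB : measurable B).

(** Gives [A] the probability that [pi x] lies in [A] and [x] in [B]. The measurability proof is an
    argument so that the measure structure can be attached to the term. *)
Definition joint_meas of measurable_fun setT pi : set Z -> \bar R :=
  pushforward (mrestr p mB) pi.
Local Notation nu := (joint_meas mpi).

Let nu0 : nu set0 = 0%E. Proof. exact: measure0. Qed.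

Let nu_ge0 A : (0 <= nu A)%E. Proof. exact: measure_ge0. Qed.

Let nu_sigma_additive : semi_sigma_additive nu.
Proof. exact: measure_semi_sigma_additive. Qed.

HB.instance Definition _ :=
  isMeasure.Build _ _ _ nu nu0 nu_ge0 nu_sigma_additive.

Let nu_finite : fin_num_fun nu.
Proof.
move=> A mA; apply: (fin_num_measure p); apply: measurableI => //.
exact: measurable_preimage.
Qed.

HB.instance Definition _ := Measure_isFinite.Build _ _ _ nu nu_finite.

End joint_meas.

Section image_prob.
Context d d' (X : measurableType d) (Z : measurableType d') (R : realType).
Variables (p : probability X R) (f : X -> Z).
Hypothesis mf : measurable_fun setT f.

Definition image_prob of measurable_fun setT f := pushforward p f.
Local Notation nu := (image_prob mf).

Let nu0 : nu set0 = 0%E. Proof. exact: measure0. Qed.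

Let nu_ge0 A : (0 <= nu A)%E. Proof. exact: measure_ge0. Qed.

Let nu_sigma_additive : semi_sigma_additive nu.
Proof. exact: measure_semi_sigma_additive. Qed.

HB.instance Definition _ :=
  isMeasure.Build _ _ _ nu nu0 nu_ge0 nu_sigma_additive.

Let nuT : nu setT = 1%E. Proof. exact: probability_setT. Qed.

HB.instance Definition _ := Measure_isProbability.Build _ _ _ nu nuT.

End image_prob.

Section random_map_kernel.
Context d0 d1 d2 (Y : measurableType d0) (W : measurableType d1)
  (X : measurableType d2) (R : realType).
Variables (U : probability W R) (q : Y * W -> X).
Hypothesis mq : measurable_fun setT q.

Let mq_pair y : measurable_fun setT (fun w => q (y, w)).
Proof. exact: (measurableT_comp mq (measurable_pair1 y)). Qed.

(** A kernel realised by external randomness [U]; with [U] uniform and [q] built from a quantile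
    function, it realises a conditional law. *)
Definition random_map_kernel : Y -> {measure set X -> \bar R} :=
  fun y => image_prob U (mq_pair y).

Let measurable_random_map_kernel B : measurable B ->
  measurable_fun setT (random_map_kernel ^~ B).
Proof.
move=> mB.
suff -> : random_map_kernel ^~ B = U \o xsection (q @^-1` B).
  exact/measurable_fun_xsection/measurable_preimage.
apply/funext => y; congr (U _).
by apply/seteqP; split=> w; rewrite /xsection/= inE.
Qed.

HB.instance Definition _ := isKernel.Build _ _ _ _ R random_map_kernel
  measurable_random_map_kernel.

Let random_map_kernel1 y : random_map_kernel y setT = 1%E.
Proof. exact: probability_setT. Qed.

HB.instance Definition _ := Kernel_isProbability.Build _ _ _ _ R
  random_map_kernel random_map_kernel1.

End random_map_kernel.

(** * Conditional probabilities and the conditional law *)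

(** On the set where [g <= f], the hypothesis and monotonicity give [f] and [g] equal integrals over
    every measurable subset, so they agree almost everywhere there. *)
Lemma ae_le_integral_le d (Z : measurableType d) (R : realType)
    (mu : {measure set Z -> \bar R}) (f g : Z -> \bar R) :
  mu.-integrable setT f -> measurable_fun setT g ->
  (forall z, (0 <= f z)%E) -> (forall z, (0 <= g z)%E) ->
  (forall A, measurable A ->
    (\int[mu]_(z in A) f z <= \int[mu]_(z in A) g z)%E) ->
  {ae mu, forall z, (f z <= g z)%E}.
Proof.
move=> fi mg f0 g0 fg; have mf := measurable_int _ fi.
pose D := [set z | (g z <= f z)%E].
have mD : measurable D by rewrite -[D]setTI; exact: measurable_lee.
have : ae_eq mu D f g.
  apply: integral_ae_eq => //.
  - exact: integrableS fi.
  - exact: measurable_funTS.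
  move=> E ED mE; apply/eqP; rewrite eq_le fg//=.
  apply: ge0_le_integral => //; try exact: measurable_funTS.
apply: filterS => z; rewrite /D/= => fgz.
by have [/fgz->//|/ltW] := leP (g z) (f z).
Qed.

(** [h] is a Radon-Nikodym derivative of [joint_meas] with respect to [p']. That derivative is at
    most 1 only almost everywhere, so it is cut off at 1. *)
Lemma conditional_probability d d' (X : measurableType d) (Z : measurableType d')
    (R : realType) (p : probability X R) (p' : probability Z R) (pi : X -> Z)
    (B : set X) : measurable_fun setT pi ->
  (forall A, measurable A -> p' A = p (pi @^-1` A)) -> measurable B ->
  exists h : Z -> R, [/\ measurable_fun setT h, forall z, 0 <= h z <= 1 &
    forall A, measurable A ->
      (\int[p']_(z in A) (h z)%:E)%E = p (pi @^-1` A `&` B)].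
Proof.
move=> mpi p'E mB.
have mpiA A : measurable A -> measurable (pi @^-1` A).
  exact: measurable_preimage.
have pB A : measurable A -> (p (pi @^-1` A `&` B) <= p (pi @^-1` A))%E.
  move=> mA; apply: le_measure; rewrite ?inE; last exact: subIsetl.
  - by apply: measurableI => //; exact: mpiA.
  - exact: mpiA.
have dom : joint_meas p mB mpi `<< p'.
  apply/null_content_dominatesP => A mA pA0.
  have {}pA0 : p (pi @^-1` A) = 0%E by rewrite -(p'E _ mA).
  by apply/eqP; rewrite -measure_le0 -pA0; exact: pB.
have [f [f0 ff fi fE]] := radon_nikodym_sigma_finite dom.
have mf := measurable_int _ fi.
have f1 : {ae p', forall z, (f z <= 1)%E}.
  apply: (ae_le_integral_le fi) => // A mA.
  rewrite -fE// integral_cst// mul1e; have /= -> := p'E _ mA; exact: pB.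
exists (fun z => Num.min (fine (f z)) 1); split.
- apply: measurable_minr => //.
  by apply: (measurableT_comp (fine_measurable _)).
- by move=> z; rewrite le_min ler01 fine_ge0//= ge_min lexx orbT.
- move=> A mA; apply: eq_trans (esym (fE A mA)); apply: ae_eq_integral => //.
  + apply/measurable_EFinP/measurable_minr => //.
    by apply/measurable_funTS/(measurableT_comp (fine_measurable _)).
  + exact: measurable_funTS.
  + apply: filterS f1 => z fz1 _ /=; rewrite min_l ?fineK//.
    by rewrite -lee_fin fineK.
Qed.

Lemma uniform_prob_le (R : realType) (c : R) : 0 <= c <= 1 ->
  uniform_prob (@ltr01 R) [set u | u <= c] = c%:E.
Proof.
move=> /andP[c0 c1]; rewrite /uniform_prob integral_uniform_pdf.
rewrite (_ : _ `&` _ = `[0, c]%classic); last first.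
  apply/seteqP; split=> u /=; rewrite !in_itv/=; first by move=> [-> /andP[->]].
  by move=> /andP[-> uc]; rewrite uc (le_trans uc).
rewrite (eq_integral (fun=> 1%E)) => [|u]; last first.
  rewrite inE/= in_itv/= => /andP[u0 uc].
  rewrite /uniform_pdf u0 (le_trans uc)//=; by rewrite subr0 invr1.
rewrite integral_cst//= mul1e lebesgue_measure_itv/= lte_fin.
case: ltP => [_|c0']; first by rewrite sube0.
by rewrite (le_anti (introT andP (conj c0' c0))).
Qed.

(** The rays generate the Borel sets of [\bar R] and are closed under intersection. They all miss
    [+oo], so [setT] joins the pi-system to supply the exhausting sequence. *)
Lemma ereal_measure_unique (R : realType)
    (m1 m2 : {measure set (\bar R) -> \bar R}) : (m1 setT < +oo)%E ->
  m1 setT = m2 setT ->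
  (forall s : R, m1 [set y | (y < s%:E)%E] = m2 [set y | (y < s%:E)%E]) ->
  forall D, measurable D -> m1 D = m2 D.
Proof.
move=> m1oo m12T m12 D mD.
pose G : set (set \bar R) :=
  [set C | C = setT \/ exists s : R, C = `]-oo, s%:E[%classic].
have itvE (s : R) : `]-oo, s%:E[%classic = [set y | (y < s%:E)%E].
  by apply/seteqP; split=> y /=; rewrite in_itv.
apply: (measure_unique G (fun=> setT)) => //.
- rewrite [LHS](ErealGenInftyO.measurableE R); apply/seteqP; split.
    by apply: sub_smallest2r => // C [s ->]; right; exists s.
  apply: smallest_sub; first exact: smallest_sigma_algebra.
  move=> C [->|[s ->]]; last by apply: sub_sigma_algebra; exists s.
  by rewrite -setC0; apply: sigma_algebraC; exact: sigma_algebra0.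
- move=> C C' [->|[s ->]]; first by rewrite setTI.
  move=> [->|[s' ->]]; first by rewrite setIT; right; exists s.
  right; exists (Num.min s s'); rewrite !itvE; apply/seteqP; split=> y /=.
    by move=> [ys ys']; rewrite EFin_min lt_min ys.
  by rewrite EFin_min lt_min => /andP[].
- by left.
- exact: bigcup_const.
- by move=> C [->//|[s ->]]; rewrite itvE.
Qed.

(** [Q (Phi z, u)] with [u] uniform is the quantile construction of the conditional law of [T]; it
    sees [z] only through the [h n z], hence through [Phi z]. The [h n] are chosen separately, so
    their order in [r n] is controlled only almost everywhere. *)
Lemma conditional_law d d' (X : measurableType d) (Z : measurableType d')
    (R : realType) (p : probability X R) (p' : probability Z R) (pi : X -> Z)
    (T : X -> R) : measurable_fun setT pi ->
  (forall A, measurable A -> p' A = p (pi @^-1` A)) -> measurable_fun setT T ->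
  exists (Phi : Z -> R) (Q : R * R -> \bar R),
    [/\ measurable_fun setT Phi, measurable_fun setT Q &
    forall A D, measurable A -> measurable D ->
      (\int[p']_(z in A) uniform_prob (@ltr01 R) [set u | D (Q (Phi z, u))])%E =
      p (pi @^-1` A `&` [set x | D (T x)%:E])].
Proof.
move=> mpi p'E mT.
have mTlt (s : R) : measurable [set x | T x < s].
  exact/measurable_true/measurable_fun_ltr.
have mpiA A : measurable A -> measurable (pi @^-1` A).
  exact: measurable_preimage.
pose r n : R := ratr (odflt 0 (unpickle n) : rat).
have [h hP] := choice (fun n => conditional_probability mpi p'E (mTlt (r n))).
have mh n : measurable_fun setT (h n) by have [] := hP n.
have h01 n z : 0 <= h n z <= 1 by have [_ /(_ z)] := hP n.
have hE n A : measurable A -> (\int[p']_(z in A) (h n z)%:E)%E =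
    p (pi @^-1` A `&` [set x | T x < r n]) by have [_ _ /(_ A)] := hP n.
have [Phi [e [mPhi eP]]] := measurable_family_code mh.
(* The infimum of the rational levels at which the conditional distribution function reaches [u];
   [+oo] is neutral for it. *)
pose Q (yu : R * R) : \bar R :=
  einfs (fun n => if yu.2 <= e n yu.1 then (r n)%:E else +oo%E) 0.
have mQ : measurable_fun setT Q.
  apply: measurable_fun_einfs => n; apply: measurable_fun_ifT => //.
  apply: measurable_fun_ler => //.
  exact: (measurableT_comp (eP n).1 measurable_fst).
have QltP z u (s : R) :
    (Q (Phi z, u) < s%:E)%E <-> exists2 n, r n < s & u <= h n z.
  split=> [|[n rs uh]].
    rewrite /Q/einfs => /ereal_inf_lt[_ [n _ <-]] /=.
    case: ifPn => // une; rewrite lte_fin => rs.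
    by exists n => //; rewrite -(eP n).2.
  apply: (@le_lt_trans _ _ (r n)%:E); last by rewrite lte_fin.
  apply: ereal_inf_lbound; exists n => //=.
  by have /= -> := (eP n).2 z; rewrite uh.
exists Phi, Q; split=> // A D mA mD.
have mq : measurable_fun setT (fun zu : Z * R => Q (Phi zu.1, zu.2)).
  apply: (measurableT_comp mQ); apply: measurable_fun_pair => //.
  exact: (measurableT_comp mPhi measurable_fst).
have mT' : measurable_fun setT (EFin \o T) by exact/measurable_EFinP.
pose k := random_map_kernel (uniform_prob (@ltr01 R)) mq.
(* With [A] fixed, both sides are finite measures in [D], to be compared on rays. *)
transitivity (mean_meas p' k mA D); first by rewrite mean_measE.
transitivity (joint_meas p (mpiA _ mA) mT' D); last first.
  by rewrite /joint_meas/pushforward/mrestr setIC.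
have mean_setT : mean_meas p' k mA setT = p' A.
  rewrite mean_measE; under eq_integral do rewrite prob_kernel.
  by rewrite integral_cst// mul1e.
apply: ereal_measure_unique mD.
- by rewrite mean_setT (le_lt_trans (probability_le1 _ _))// ltry.
- by rewrite mean_setT p'E//; exact: (congr1 p (esym (setTI _))).
move=> s; rewrite mean_measE.
(* A version of the conditional probability of [T < s] at the real level [s], against which the
   rational levels are compared. *)
have [H [mH H01 HE]] := conditional_probability mpi p'E (mTlt s).
transitivity (p (pi @^-1` A `&` [set x | T x < s])); last first.
  by rewrite /joint_meas/pushforward/mrestr setIC.
have kE z : k z [set y | (y < s%:E)%E] =
  uniform_prob (@ltr01 R) [set u | exists2 n, r n < s & u <= h n z].
  by congr (uniform_prob _ _); apply/seteqP; split=> u /QltP.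
have mS z : measurable [set u : R | exists2 n, r n < s & u <= h n z].
  rewrite (_ : [set u | _] =
      \bigcup_(n in [set n | r n < s]) [set u | u <= h n z]).
    apply: bigcup_measurable => n _.
    exact/measurable_true/measurable_fun_ler.
  by apply/seteqP; split=> u [n]; exists n.
have mle (c : R) : measurable [set u : R | u <= c].
  exact/measurable_true/measurable_fun_ler.
have mk : measurable_fun A (fun z => k z [set y | (y < s%:E)%E]).
  apply: measurable_funTS; apply: measurable_kernel.
  by rewrite -[X in measurable X]setTI; exact: emeasurable_fun_infty_o.
(* Upper bound: for almost every [z], every [h n z] with [r n < s] is at most [H z], so the set in
   [kE] lies in that of the [u <= H z]. *)
apply/eqP; rewrite eq_le; apply/andP; split.
  rewrite -HE//; apply: ae_ge0_le_integral => //.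
  - by move=> z _; rewrite lee_fin; have /andP[] := H01 z.
  - exact/measurable_EFinP/measurable_funTS.
  have : {ae p', forall z n, r n < s -> h n z <= H z}.
    apply: ae_foralln => n; have [rs|rs] := boolP (r n < s); last exact: aeW.
    suff : {ae p', forall z, ((h n z)%:E <= (H z)%:E)%E}.
      by apply: filterS => z; rewrite lee_fin.
    apply: ae_le_integral_le.
    - apply: measurable_bounded_integrable => //.
        by rewrite (le_lt_trans (probability_le1 _ _))// ltry.
      exists 1; split=> // M M1 z _ /=; have /andP[h0 h1] := h01 n z.
      by rewrite ger0_norm// (le_trans h1)// ltW.
    - exact/measurable_EFinP.
    - by move=> z; rewrite lee_fin; have /andP[] := h01 n z.
    - by move=> z; rewrite lee_fin; have /andP[] := H01 z.
    move=> C mC; rewrite hE// HE//; apply: le_measure; rewrite ?inE.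
    - by apply: measurableI => //; exact: mpiA.
    - by apply: measurableI => //; exact: mpiA.
    - by move=> x [Cx Txr]; split=> //; exact: lt_trans Txr rs.
  apply: filterS => z hH _; rewrite kE -(uniform_prob_le (H01 z)).
  apply: le_measure; rewrite ?inE; [exact: mS|exact: mle|].
  move=> u [n rs uh] /=; exact: le_trans uh (hH n rs).
(* Lower bound: continuity from below replaces [s] by [s - j.+1%:R^-1], leaving room for a rational
   level below [s], whose [h] is dominated by the kernel at every [z]. *)
pose F j := pi @^-1` A `&` [set x | T x < s - j.+1%:R^-1].
have mF j : measurable (F j) by apply: measurableI => //; exact: mpiA.
have FE : pi @^-1` A `&` [set x | T x < s] = \bigcup_j F j.
  apply/seteqP; split=> [x [Ax /= Txs]|x [j _ [Ax /= Txs]]]; last first.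
    by split=> //=; rewrite (lt_le_trans Txs)// gerBl invr_ge0.
  near \oo => j; exists j => //; split=> //=.
  rewrite ltrBrDr -ltrBrDl; near: j.
  have sT : 0 < s - T x by rewrite subr_gt0.
  exact: near_infty_natSinv_lt (PosNum sT).
have cF : p (F j) @[j --> \oo] --> p (\bigcup_j F j).
  apply: nondecreasing_cvg_mu => //; first exact: bigcupT_measurable.
  move=> i j ij; apply/subsetPset => x [Ax /= Txs]; split=> //=.
  rewrite (lt_le_trans Txs)// lerB// lef_pV2 ?posrE// ler_nat ltnS//.
rewrite FE -(cvg_lim _ cF)//; apply: lime_le.
  by apply/cvg_ex; eexists; exact: cF.
apply: nearW => j.
have [q] : exists q : rat, ratr q \in `]s - j.+1%:R^-1, s[.
  by apply: rat_in_itvoo; rewrite gtrBl invr_gt0.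
rewrite in_itv/= => /andP[jq qs].
have rq : r (pickle q) = ratr q by rewrite /r pickleK.
apply: (@le_trans _ _ (p (pi @^-1` A `&` [set x | T x < r (pickle q)]))).
  apply: le_measure; rewrite ?inE//.
    by apply: measurableI => //; exact: mpiA.
  by move=> x [Ax /= Txs]; split=> //=; rewrite rq; exact: lt_trans jq.
rewrite -hE//; apply: ge0_le_integral => //.
- by move=> z _; rewrite lee_fin; have /andP[] := h01 (pickle q) z.
- exact/measurable_EFinP/measurable_funTS.
move=> z _; rewrite -[leRHS]/(k z [set y | (y < s%:E)%E]) kE.
rewrite -(uniform_prob_le (h01 (pickle q) z)).
apply: le_measure; rewrite ?inE; [exact: mle|exact: mS|].
by move=> u /= uh; exists (pickle q) => //; rewrite rq.
Unshelve. all: by end_near.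
Qed.

(** * The isomorphism with a probability measure on the line *)

Lemma standard_borel_real (R : realType) : standard_borel R R.
Proof.
exists R^o, id; split; [split| |].
- move=> F FF cF; exists (lim F); exact: cauchy_cvg.
- exists (range (@ratr R)); last exact: dense_rat.
  exact: sub_countable (card_image_le _ _) _.
- by exists id.
- move=> B; rewrite preimage_id; split.
    apply: smallest_sub => [|O oO]; first exact: sigma_algebra_measurable.
    exact: open_measurable.
  have mE : @measurable _ R = <<s @RGenOpens.G R >> := RGenOpens.measurableE R.
  rewrite mE; move: B.
  apply: sub_smallest2r; first exact: smallest_sigma_algebra.
  by move=> _ [x [y ->]]; exact: interval_open.
Qed.

Lemma measure_preserving_image_isomorphic d d' (X : measurableType d)
    (Z : measurableType d') (R : realType) (p : probability X R)
    (p' : probability Z R) (pi : X -> Z) :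
  standard_borel R X -> measurable_fun setT pi ->
  (forall A, measurable A -> p' A = p (pi @^-1` A)) ->
  exists q : probability R R, ps_isomorphic (ProbSpace Z p') (ProbSpace R q).
Proof.
move=> sX mpi p'E.
(* Total mass 1 makes [X] nonempty, which provides the default value of the retraction. *)
have [x0 _] : [set: X] !=set0.
  apply/set0P/eqP => X0; have := probability_setT p; rewrite X0 measure0.
  by move/eqP; rewrite lt_eqF// lte01.
have [T [g [mT mg gT]]] := standard_borel_retract x0 sX.
have [Phi [Q [mPhi mQ L]]] := conditional_law mpi p'E mT.
have mgf : measurable_fun setT (pi \o (g \o @fine R)).
  apply: measurableT_comp mpi _; apply: measurableT_comp mg _.
  exact: fine_measurable.
(* [k t] takes the quantile [Q (t, u)] at a uniform [u], decodes it to a point of [X] and applies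
   [pi]. [fine] sends infinite quantiles to 0; this does no harm, as [L] compares with the finite
   values of [T]. *)
pose k := random_map_kernel (uniform_prob (@ltr01 R)) (measurableT_comp mgf mQ).
(* Since [g] undoes [T], the conditional law of [T] is carried to that of [pi] given [pi]: in
   integrated form, the point mass at [z]. *)
have kE A B : measurable A -> measurable B ->
    (\int[p']_(z in A) k (Phi z) B)%E = p' (A `&` B).
  move=> mA mB; rewrite p'E; last exact: measurableI.
  rewrite (L A ((pi \o (g \o @fine R)) @^-1` B))//; last exact: measurable_preimage.
  by congr (p (_ `&` _)); apply/seteqP; split=> x /=; rewrite gT.
have mk B : measurable B -> measurable_fun setT (k ^~ B) := measurable_kernel k B.
pose q : probability R R := image_prob p' mPhi.
have qE A (u : R -> \bar R) : measurable A -> measurable_fun setT u ->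
    (forall y, 0 <= u y)%E ->
    (\int[q]_(y in A) u y = \int[p']_(z in Phi @^-1` A) u (Phi z))%E.
  move=> mA mu u0; apply: ge0_integral_pushforward => //.
  exact: measurable_funTS.
pose f : R.-pker Z ~> R := kdirac mPhi.
have fP B : measurable B -> q B = (\int[p']_z f z B)%E.
  move=> mB; have mPB := measurable_preimage mPhi mB.
  rewrite (_ : (fun z => f z B) = fun z => (\1_(Phi @^-1` B) z)%:E)//.
  by rewrite integral_indic ?setIT.
have kP B : measurable B -> p' B = (\int[q]_y k y B)%E.
  by move=> mB; rewrite (qE _ (k ^~ B) measurableT (mk _ mB))// (kE setT)// setTI.
pose F := @PSMap R (ProbSpace Z p') (ProbSpace R q) f fP.
pose K := @PSMap R (ProbSpace R q) (ProbSpace Z p') k kP.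
exists q, (ps_class F), (ps_class K).
split; rewrite ps_compE; apply/ps_classP => A B mA mB /=.
- transitivity (\int[p']_(z in A) k (Phi z) B)%E.
    apply: eq_integral => z _; rewrite markov_compE integral_dirac//;
      last exact: mk.
    by rewrite diracT mul1e.
  rewrite kE//; under eq_integral do rewrite markov_idE.
  by rewrite integral_indic// setIC.
(* This composite reduces to [kE] for the preimages of [A] and [B] under [Phi]. *)
- have mPB := measurable_preimage mPhi mB.
  transitivity (\int[q]_(y in A) k y (Phi @^-1` B))%E.
    apply: eq_integral => y _; rewrite markov_compE.
    rewrite (_ : (fun z => f z B) = fun z => (\1_(Phi @^-1` B) z)%:E)//.
    by rewrite integral_indic ?setIT.
  rewrite (qE _ (k ^~ (Phi @^-1` B)) mA (mk _ mPB))// kE//;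
    last exact: measurable_preimage.
  under eq_integral do rewrite markov_idE.
  by rewrite integral_indic// setIC.
Qed.

Theorem corollary3p18 (R : realType) (d : measure_display)
    (X : measurableType d) (p : probability X R)
    (G : set (set X)) (p' : probability (g_sigma_algebraType G) R) :
  standard_borel R X ->
  sigma_algebra [set: X] G ->
  G `<=` measurable ->
  (forall A : set X, G A -> p' A = p A) ->
  exists Y : prob_space R,
    standard_borel R Y /\
    ps_isomorphic (ProbSpace (g_sigma_algebraType G) p') Y.
Proof.
move=> sX sG Gm p'G.
(* As [G] is already a sigma-algebra, generating adds no sets, and [id] from [X] to the coarser
   space is measurable by [Gm]. *)
have GE : <<s G >> = G by exact: sigma_algebra_id.
have mG (A : set (g_sigma_algebraType G)) : measurable A -> G A.
  by move=> mA; rewrite -GE.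
have [||q iso] := @measure_preserving_image_isomorphic _ _ X
    (g_sigma_algebraType G) R p p' id sX.
- by move=> _ A /mG/Gm; rewrite setTI.
- by move=> A /mG/p'G.
by exists (ProbSpace R q); split => //; exact: standard_borel_real.
Qed.
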